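(* Let $c_0$ be the complex Banach space of complex sequences converging to $0$ with the supremum norm. Then the Bishop-Phelps-Bollobás theorem holds for $\mathcal{B}(c_0\times c_0)$, that is, the pair $(c_0,c_0)$ has the Bishop-Phelps-Bollobás property for bilinear forms.
   Context: All Banach spaces are complex. For a Banach space $X$, $S_X$ is its unit sphere. For Banach spaces $X,Y$, $\mathcal{B}(X\times Y)$ is the space of all bounded bilinear forms $B:X\times Y\to\mathbb{C}$ (linear in each variable), with norm $\|B\|=\sup\{|B(x,y)|: \|x\|\le 1,\ \|y\|\le 1\}$. A pair $(X,Y)$ of Banach spaces has the Bishop-Phelps-Bollobás property for bilinear forms (equivalently, one says that the Bishop-Phelps-Bollobás theorem holds for $\mathcal{B}(X\times Y)$) if for every $0<\varepsilon<1$ there is $\eta(\varepsilon)>0$ such that given $B\in\mathcal{B}(X\times Y)$ with $\|B\|=1$ and $(x_0,y_0)\in S_X\times S_Y$ satisfying $|B(x_0,y_0)|>1-\eta(\varepsilon)$, there exist $(x_1,y_1)\in S_X\times S_Y$ and $S\in\mathcal{B}(X\times Y)$ with $\|S\|=1$ satisfying $|S(x_1,y_1)|=1$, $\|x_0-x_1\|<\varepsilon$, $\|y_0-y_1\|<\varepsilon$ and $\|S-B\|<\varepsilon$. *)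

(* Defs.v *)
From Stdlib Require Import Reals Lra Lia.
From Stdlib Require Import FunctionalExtensionality PropExtensionality.
From Stdlib Require Import ProofIrrelevance ClassicalEpsilon.
From Coquelicot Require Import Coquelicot.

Set Implicit Arguments.
Unset Strict Implicit.
Unset Printing Implicit Defensive.

Open Scope R_scope.

Section BishopPhelpsBollobas.

Variables X Y : CompleteNormedModule C_AbsRing.

Record is_bounded_bilinear (B : X -> Y -> C) : Prop := {
  bilinear_plus_l : forall x1 x2 y, B (plus x1 x2) y = (B x1 y + B x2 y)%C;
  bilinear_scal_l : forall (a : C) x y, B (scal a x) y = (a * B x y)%C;
  bilinear_plus_r : forall x y1 y2, B x (plus y1 y2) = (B x y1 + B x y2)%C;
  bilinear_scal_r : forall (a : C) x y, B x (scal a y) = (a * B x y)%C;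
  bilinear_bounded :
    exists M : R, forall x y, Cmod (B x y) <= M * norm x * norm y
}.

(* [real] sends an infinite supremum to 0; for a bounded bilinear form the
   supremum is finite, see [bilinear_norm_lub]. *)
Definition bilinear_norm (B : X -> Y -> C) : R :=
  real (Lub_Rbar (fun r => exists x y,
    norm x <= 1 /\ norm y <= 1 /\ r = Cmod (B x y))).

Lemma bilinear_norm_lub (B : X -> Y -> C) : is_bounded_bilinear B ->
  is_lub_Rbar (fun r => exists x y,
    norm x <= 1 /\ norm y <= 1 /\ r = Cmod (B x y))
    (Finite (bilinear_norm B)).
Proof.
intros [_ _ _ _ [M HM]]; unfold bilinear_norm.
match goal with |- is_lub_Rbar ?E _ => assert (H := Lub_Rbar_correct E) end.
destruct (Lub_Rbar _) as [s| |]; [exact H| |]; exfalso.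
- destruct H as [_ H].
  apply (H (Finite (Rabs M))); intros r (x & y & Hx & Hy & ->); simpl.
  eapply Rle_trans; [apply HM|].
  assert (H1 := norm_ge_0 x); assert (H2 := norm_ge_0 y).
  assert (H3 := Rle_abs M); assert (H4 := Rabs_pos M).
  assert (H5 : 0 <= norm x * norm y <= 1) by nra.
  rewrite Rmult_assoc; nra.
- destruct H as [H _].
  apply (H (Cmod (B zero zero))); exists zero, zero.
  rewrite !norm_zero; repeat split; lra.
Qed.

Definition BPBp_bilinear : Prop :=
  forall eps : R, 0 < eps < 1 ->
  exists eta : R, 0 < eta /\
  forall B : X -> Y -> C, is_bounded_bilinear B -> bilinear_norm B = 1 ->
  forall (x0 : X) (y0 : Y), norm x0 = 1 -> norm y0 = 1 ->
  Cmod (B x0 y0) > 1 - eta ->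
  exists (x1 : X) (y1 : Y) (S : X -> Y -> C),
    norm x1 = 1 /\ norm y1 = 1 /\
    is_bounded_bilinear S /\ bilinear_norm S = 1 /\
    Cmod (S x1 y1) = 1 /\
    norm (minus x0 x1) < eps /\
    norm (minus y0 y1) < eps /\
    bilinear_norm (fun x y => S x y - B x y)%C < eps.

End BishopPhelpsBollobas.

Record c0 : Type := C0 {
  c0_seq :> nat -> C;
  c0_cvg : filterlim c0_seq eventually (locally (RtoC 0))
}.

Lemma c0_ext (u v : c0) : (forall n, u n = v n) -> u = v.
Proof.
destruct u as [u Hu], v as [v Hv]; simpl; intros E.
apply functional_extensionality in E; subst v.
now rewrite (proof_irrelevance _ Hu Hv).
Qed.

Lemma c0_cvg_Cmod (u : nat -> C) :
  filterlim u eventually (locally (RtoC 0)) <->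
  (forall eps : R, 0 < eps ->
     exists N, forall n, (N <= n)%nat -> Cmod (u n) < eps).
Proof.
split.
- intros Hu eps He.
  assert (H : filterlim (fun n => Cmod (u n)) eventually (locally (Cmod 0))).
  { eapply filterlim_comp; [exact Hu|].
    exact (@filterlim_norm C_AbsRing C_NormedModule (RtoC 0)). }
  rewrite Cmod_0 in H.
  destruct (proj1 (filterlim_locally _ _) H (mkposreal eps He)) as [N HN].
  exists N; intros n Hn; specialize (HN n Hn).
  revert HN; unfold ball; simpl; unfold AbsRing_ball, abs, minus, plus, opp.
  simpl; rewrite Ropp_0, Rplus_0_r, Rabs_pos_eq; auto using Cmod_ge_0.
- intros H.
  apply (@filterlim_norm_zero nat C_AbsRing C_NormedModule eventually _ u).
  apply filterlim_locally; intros eps.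
  destruct (H eps (cond_pos eps)) as [N HN].
  exists N; intros n Hn; specialize (HN n Hn).
  unfold ball; simpl; unfold AbsRing_ball, abs, minus, plus, opp.
  change (@norm C_AbsRing C_NormedModule (u n)) with (Cmod (u n)).
  simpl; rewrite Ropp_0, Rplus_0_r, Rabs_pos_eq; auto using Cmod_ge_0.
Qed.

Lemma c0_zero_cvg : filterlim (fun _ : nat => RtoC 0) eventually (locally (RtoC 0)).
Proof. apply filterlim_const. Qed.

Lemma c0_plus_cvg (u v : c0) :
  filterlim (fun n => u n + v n)%C eventually (locally (RtoC 0)).
Proof.
apply c0_cvg_Cmod; intros eps He.
destruct (proj1 (c0_cvg_Cmod _) (c0_cvg u) (eps / 2)) as [N HN]; [lra|].
destruct (proj1 (c0_cvg_Cmod _) (c0_cvg v) (eps / 2)) as [M HM]; [lra|].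
exists (max N M); intros n Hn.
assert (H1 := HN n ltac:(lia)); assert (H2 := HM n ltac:(lia)).
assert (H3 := Cmod_triangle (u n) (v n)); lra.
Qed.

Lemma c0_scal_cvg (a : C) (u : c0) :
  filterlim (fun n => a * u n)%C eventually (locally (RtoC 0)).
Proof.
apply c0_cvg_Cmod; intros eps He.
assert (Ha := Cmod_ge_0 a).
destruct (proj1 (c0_cvg_Cmod _) (c0_cvg u) (eps / (Cmod a + 1))) as [N HN].
{ apply Rdiv_lt_0_compat; lra. }
exists N; intros n Hn; specialize (HN n Hn).
rewrite Cmod_mult; assert (Hu := Cmod_ge_0 (u n)).
apply Rmult_lt_compat_r with (r := Cmod a + 1) in HN; [|lra].
unfold Rdiv in HN; rewrite Rmult_assoc, Rinv_l in HN by lra.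
nra.
Qed.

Lemma c0_opp_cvg (u : c0) :
  filterlim (fun n => - u n)%C eventually (locally (RtoC 0)).
Proof.
apply c0_cvg_Cmod; intros eps He.
destruct (proj1 (c0_cvg_Cmod _) (c0_cvg u) eps He) as [N HN].
exists N; intros n Hn; rewrite Cmod_opp; auto.
Qed.

Definition c0_zero : c0 := C0 c0_zero_cvg.
Definition c0_plus (u v : c0) : c0 := C0 (c0_plus_cvg u v).
Definition c0_opp (u : c0) : c0 := C0 (c0_opp_cvg u).
Definition c0_scal (a : C) (u : c0) : c0 := C0 (c0_scal_cvg a u).

Definition c0_norm (u : c0) : R :=
  real (Sup_seq (fun n => Finite (Cmod (u n)))).

Lemma c0_norm_sup (u : c0) :
  is_sup_seq (fun n => Finite (Cmod (u n))) (Finite (c0_norm u)).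
Proof.
unfold c0_norm; assert (H := Sup_seq_correct (fun n => Finite (Cmod (u n)))).
destruct (Sup_seq _) as [s| |]; [exact H| |]; exfalso.
- destruct (@filterlim_bounded C_AbsRing C_NormedModule (c0_seq u)) as [M HM].
  { exists (RtoC 0); apply c0_cvg. }
  destruct (H M) as [n Hn]; specialize (HM n); simpl in Hn.
  change (Cmod (u n) <= M) in HM; lra.
- assert (Hn := H 0 0%nat); simpl in Hn.
  assert (H0 := Cmod_ge_0 (u 0%nat)); lra.
Qed.

Lemma c0_norm_ge (u : c0) n : Cmod (u n) <= c0_norm u.
Proof.
apply Rle_plus_epsilon; intros eps He.
destruct (c0_norm_sup u (mkposreal eps He)) as [H _].
specialize (H n); simpl in H; lra.
Qed.

Lemma c0_norm_le (u : c0) M : (forall n, Cmod (u n) <= M) -> c0_norm u <= M.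
Proof.
intros HM; apply Rle_plus_epsilon; intros eps He.
destruct (c0_norm_sup u (mkposreal eps He)) as [_ [n Hn]].
specialize (HM n); simpl in Hn; lra.
Qed.

Definition c0_AbelianMonoid_mixin : AbelianMonoid.mixin_of c0.
Proof.
apply (@AbelianMonoid.Mixin c0 c0_plus c0_zero);
  intros; apply c0_ext; intros n; simpl; ring.
Defined.

Canonical c0_AbelianMonoid :=
  AbelianMonoid.Pack c0 c0_AbelianMonoid_mixin c0.

Definition c0_AbelianGroup_mixin : AbelianGroup.mixin_of c0_AbelianMonoid.
Proof.
apply (@AbelianGroup.Mixin c0_AbelianMonoid c0_opp).
intros; apply c0_ext; intros n; simpl; ring.
Defined.

Canonical c0_AbelianGroup :=
  AbelianGroup.Pack c0
    (AbelianGroup.Class c0 c0_AbelianMonoid_mixin c0_AbelianGroup_mixin) c0.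

Definition c0_ModuleSpace_mixin :
  ModuleSpace.mixin_of C_Ring c0_AbelianGroup.
Proof.
apply (@ModuleSpace.Mixin C_Ring c0_AbelianGroup c0_scal);
  intros; apply c0_ext; intros n; simpl;
  unfold mult, plus, one; simpl; ring.
Defined.

Canonical c0_ModuleSpace :=
  ModuleSpace.Pack C_Ring c0
    (ModuleSpace.Class C_Ring c0 _ c0_ModuleSpace_mixin) c0.

Definition c0_ball (u : c0) (e : R) (v : c0) : Prop :=
  c0_norm (minus v u) < e.

Lemma c0_norm_triangle (u v : c0) :
  c0_norm (plus u v) <= c0_norm u + c0_norm v.
Proof.
apply c0_norm_le; intros n.
eapply Rle_trans; [apply (Cmod_triangle (u n) (v n))|].
apply Rplus_le_compat; apply c0_norm_ge.
Qed.

Definition c0_UniformSpace_mixin : UniformSpace.mixin_of c0.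
Proof.
apply (@UniformSpace.Mixin c0 c0_zero c0_ball); unfold c0_ball.
- intros u e; apply Rle_lt_trans with 0; [|apply cond_pos].
  apply c0_norm_le; intros n; rewrite minus_eq_zero; simpl.
  rewrite Cmod_0; lra.
- intros u v e; apply Rle_lt_trans; apply c0_norm_le; intros n.
  eapply Rle_trans; [|apply (c0_norm_ge _ n)].
  rewrite <- opp_minus; simpl; rewrite Cmod_opp; lra.
- intros u v w e1 e2 H1 H2.
  rewrite (minus_trans v w u).
  eapply Rle_lt_trans; [apply c0_norm_triangle|lra].
Defined.

Canonical c0_UniformSpace :=
  UniformSpace.Pack c0 c0_UniformSpace_mixin c0.

Canonical c0_NormedModuleAux :=
  NormedModuleAux.Pack C_AbsRing c0
    (NormedModuleAux.Class C_AbsRing c0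
       (ModuleSpace.class C_Ring c0_ModuleSpace) c0_UniformSpace_mixin) c0.

Definition c0_NormedModule_mixin :
  NormedModule.mixin_of C_AbsRing c0_NormedModuleAux.
Proof.
apply (@NormedModule.Mixin C_AbsRing c0_NormedModuleAux c0_norm 1).
- exact c0_norm_triangle.
- intros a u; apply c0_norm_le; intros n; simpl.
  rewrite Cmod_mult; apply Rmult_le_compat_l; [apply Cmod_ge_0|].
  apply c0_norm_ge.
- now intros u v eps H.
- intros u v eps H; rewrite Rmult_1_l; exact H.
- intros u Hu; apply c0_ext; intros n; apply Cmod_eq_0.
  apply Rle_antisym; [|apply Cmod_ge_0].
  rewrite <- Hu; apply c0_norm_ge.
Defined.

Canonical c0_NormedModule :=
  NormedModule.Pack C_AbsRing c0
    (NormedModule.Class C_AbsRing c0 _ c0_NormedModule_mixin) c0.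

Lemma c0_complete (F : (c0 -> Prop) -> Prop) :
  ProperFilter F -> cauchy F ->
  exists u : c0, forall eps : posreal, F (ball u eps).
Proof.
intros PF CF.
pose (Fn := fun n => filtermap (fun u : c0 => u n) F).
pose (l := fun n => @lim C_CompleteNormedModule (Fn n)).
assert (Hl : forall n (e : posreal), Fn n (fun z => Cmod (z - l n)%C < e)).
{ intros n e.
  assert (HC : forall d : posreal, Fn n (@ball C_UniformSpace (l n) d)).
  { apply (@complete_cauchy C_CompleteNormedModule).
    - apply filtermap_proper_filter; exact PF.
    - intros d; destruct (CF d) as [u Hu]; exists (u n).
      unfold Fn, filtermap; revert Hu; apply filter_imp.
      intros v Hv.
      apply (@norm_compat1 C_AbsRing C_NormedModule).
      eapply Rle_lt_trans; [|exact Hv].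
      apply (c0_norm_ge (minus v u) n). }
  pose (k := @norm_factor C_AbsRing C_NormedModule).
  assert (Hk : 0 < k) by apply norm_factor_gt_0.
  assert (Hd : 0 < e / k).
  { apply Rdiv_lt_0_compat; [apply cond_pos|exact Hk]. }
  generalize (HC (mkposreal _ Hd)); apply filter_imp; intros z Hz.
  apply (@norm_compat2 C_AbsRing C_NormedModule) in Hz; simpl in Hz.
  replace (pos e) with (k * (e / k)) by (field; lra).
  exact Hz. }
assert (Key : forall (e : posreal) (u : c0), F (ball u e) ->
                forall n, Cmod (u n - l n)%C <= e).
{ intros e u Hu n; apply Rle_plus_epsilon; intros d Hd.
  assert (HF : F (fun v => Cmod (v n - l n)%C < d))
    by exact (Hl n (mkposreal d Hd)).
  destruct (filter_ex _ (filter_and _ _ Hu HF)) as [v [H1 H2]].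
  assert (H3 : Cmod (v n - u n)%C < e).
  { eapply Rle_lt_trans; [|exact H1]; apply (c0_norm_ge (minus v u) n). }
  replace (u n - l n)%C with ((v n - l n) + - (v n - u n))%C by ring.
  eapply Rle_trans; [apply Cmod_triangle|].
  rewrite Cmod_opp; lra. }
assert (H0 : filterlim l eventually (locally (RtoC 0))).
{ apply c0_cvg_Cmod; intros eps He.
  assert (He2 : 0 < eps / 2) by lra.
  destruct (CF (mkposreal _ He2)) as [u Hu].
  destruct (proj1 (c0_cvg_Cmod _) (c0_cvg u) _ He2) as [N HN].
  exists N; intros n Hn; specialize (HN n Hn).
  assert (H := Key _ _ Hu n); simpl in H.
  replace (l n) with (u n + - (u n - l n))%C by ring.
  eapply Rle_lt_trans; [apply Cmod_triangle|].
  rewrite Cmod_opp; lra. }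
exists (C0 H0); intros eps.
assert (He : 0 < eps / 3) by (assert (H := cond_pos eps); lra).
destruct (CF (mkposreal _ He)) as [u Hu].
generalize Hu; apply filter_imp; intros v Hv.
apply Rle_lt_trans with (eps / 3 + eps / 3);
  [|assert (H := cond_pos eps); lra].
apply c0_norm_le; intros n.
assert (H := Key _ _ Hu n); simpl in H.
assert (H1 : Cmod (v n - u n)%C < eps / 3).
{ eapply Rle_lt_trans; [|exact Hv]; apply (c0_norm_ge (minus v u) n). }
change (Cmod (v n - l n)%C <= eps / 3 + eps / 3).
replace (v n - l n)%C with ((v n - u n) + (u n - l n))%C by ring.
eapply Rle_trans; [apply Cmod_triangle|]; lra.
Qed.

Definition c0_lim (F : (c0 -> Prop) -> Prop) : c0 :=
  epsilon (inhabits c0_zero) (fun u => forall eps : posreal, F (ball u eps)).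

Definition c0_CompleteSpace_mixin : CompleteSpace.mixin_of c0_UniformSpace.
Proof.
apply (@CompleteSpace.Mixin c0_UniformSpace c0_lim).
- intros F PF CF; unfold c0_lim; apply epsilon_spec.
  exact (c0_complete PF CF).
- intros F1 F2 H12 H21.
  replace F2 with F1; [intros eps; apply ball_center|].
  apply functional_extensionality; intros P.
  apply propositional_extensionality; split; auto.
Defined.

Canonical c0_CompleteSpace :=
  CompleteSpace.Pack c0
    (CompleteSpace.Class c0 _ c0_CompleteSpace_mixin) c0.

Canonical c0_CompleteNormedModule :=
  CompleteNormedModule.Pack C_AbsRing c0
    (CompleteNormedModule.Class C_AbsRing c0
       (NormedModule.class C_AbsRing c0_NormedModule)
       c0_CompleteSpace_mixin) c0.

(* Main.v *)
Require Import Defs.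
From Stdlib Require Import Reals Lra Lia Arith ClassicalEpsilon.
From Coquelicot Require Import Coquelicot.

(** Let [B] have norm [1] and nearly attain it at [(x0, y0)]. Perturb [B] to
    [S(x, y) = B(x, y) + e k B(x, y0) B(x0, y)], where the unimodular [k] makes
    both terms of [S(x0, y0)] point in the same direction. Restricted to the
    vectors supported in the first [N] coordinates, [S] attains its norm [m] at
    some [(x, y)] ([bilinear_max_finite_ball]), and [m] is at least about
    [|S(x0, y0)|], which is nearly [1 + e]. Hence [|B(x, y0)|] and [|B(x0, y)|]
    are both nearly [1]. The vector [x] may nevertheless be far from [x0], so
    [S] has to be moved.

    After a rotation of [x], the midpoint of [x0] and [x] also nearly norms
    [B(., y0)]. On the set [D] of the coordinates where [x] and [x0] differ by at
    least [e], or which are beyond [N], the midpoint has modulus at most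
    [1 - e^2/8]. So for [z] in the unit ball supported in [D], adding
    [l (e^2/8) z] to the midpoint does not leave the unit ball, for any complex
    [l] in the disc. Since the dual of the sequence space is complex uniformly
    convex ([linear_complex_convexity]), the functional [B(z, .)] is small: [B]
    hardly sees the coordinates in [D].

    Consequently [x] can be replaced by [x1], equal to [x] outside [D] and to [x0]
    on [D], at no cost: a contraction [U] with [U x1 = x] that alters essentially
    the coordinates in [D] only satisfies [B(U w, v) ~ B(w, v)]
    ([vector_transport]). With [V] and [y1] obtained in the same way from [y],
    the form [S(U w, V v) / m] attains its norm [1] at [(x1, y1)] and is close to
    [B]. All the estimates depend on [e] alone, which gives the uniformity. *)

Set Implicit Arguments.
Unset Strict Implicit.
Open Scope R_scope.

Lemma functional_choice (A T : Type) (P : A -> T -> Prop) :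
  (forall a, exists b, P a b) -> exists f, forall a, P a (f a).
Proof.
intros H.
exists (fun a => proj1_sig (constructive_indefinite_description _ (H a))).
intros a; apply (proj2_sig (constructive_indefinite_description _ (H a))).
Qed.

(** * Complex scalars *)

Lemma Cmod_le_sqr (z : C) (r : R) :
  0 <= r -> Re z ^ 2 + Im z ^ 2 <= r ^ 2 -> Cmod z <= r.
Proof.
intros Hr H; rewrite <- Cmod2_alt in H.
assert (H0 := Cmod_ge_0 z); nra.
Qed.

Lemma Cphase (z : C) : exists u : C, Cmod u = 1 /\ (u * z = RtoC (Cmod z))%C.
Proof.
destruct (Req_dec (Cmod z) 0) as [E|E].
- exists (RtoC 1); rewrite Cmod_1; split; [reflexivity|].
  now rewrite E, (Cmod_eq_0 z E), Cmult_0_r.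
- assert (E' : RtoC (Cmod z) <> 0%C).
  { intros K; apply E; now apply (f_equal Re) in K. }
  exists (Cconj z / Cmod z)%C; split.
  + rewrite Cmod_div, Cmod_conj, Cmod_R, Rabs_pos_eq by auto using Cmod_ge_0.
    now field.
  + replace (Cconj z / Cmod z * z)%C with (z * Cconj z / Cmod z)%C
      by (now field).
    rewrite <- Cmod2_conj, RtoC_pow; now field.
Qed.

(** [l] rotates [w] to the direction of [z]. *)
Lemma Calign (z w : C) :
  exists l : C, Cmod l = 1 /\ Cmod (z + l * w) = Cmod z + Cmod w.
Proof.
destruct (Cphase z) as (u & Hu & Eu), (Cphase w) as (v & Hv & Ev).
exists (Cconj u * v)%C; split.
{ rewrite Cmod_mult, Cmod_conj, Hu, Hv; ring. }
assert (Huu : (u * Cconj u = 1)%C).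
{ rewrite <- Cmod2_conj, Hu; apply f_equal; ring. }
rewrite <- (Rmult_1_l (Cmod (_ + _))), <- Hu, <- Cmod_mult.
replace (u * (z + Cconj u * v * w))%C with (u * z + u * Cconj u * (v * w))%C
  by ring.
rewrite Huu, Eu, Ev, Cmult_1_l, <- RtoC_plus, Cmod_R.
apply Rabs_pos_eq; assert (H := Cmod_ge_0 z); assert (H' := Cmod_ge_0 w); lra.
Qed.

(** The witness is [u = max(|c|,|d|)] times the phase of [c]. Since [c] is the
    midpoint of [u] and [2 c - u], both in the disc, a functional that nearly
    attains its norm at [c] does so at [u] too; and [u] dominates [d]. The bound
    by [|c| + |d|] keeps sequences of such [u] convergent to [0]. *)
Lemma Cmidpoint_dominating (c d : C) : Cmod c <= 1 -> Cmod d <= 1 ->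
  exists (u : C) (p q : R),
    Cmod u <= 1 /\ Cmod u <= Cmod c + Cmod d /\ Cmod (2 * c - u) <= 1 /\
    Rabs p <= 1 /\ Rabs q <= 1 /\ d = (u * p + Ci * (u * q))%C.
Proof.
intros Hc Hd.
assert (Hc0 := Cmod_ge_0 c); assert (Hd0 := Cmod_ge_0 d).
destruct (Req_dec (Cmod c) 0) as [E|E].
{ exists d, 1, 0; rewrite (Cmod_eq_0 c E), Cmod_0.
  replace (2 * 0 - d)%C with (- d)%C by ring.
  rewrite Cmod_opp, Rabs_R1, Rabs_R0; repeat split; try lra; ring. }
set (m := Rmax (Cmod c) (Cmod d)).
assert (Hm : Cmod c <= m) by apply Rmax_l.
assert (Hm' : Cmod d <= m) by apply Rmax_r.
assert (Hm1 : m <= 1) by (apply Rmax_lub; lra).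
assert (Hm2 : m <= Cmod c + Cmod d) by (apply Rmax_lub; lra).
assert (HA : forall r : R, Cmod (r * c)%C = Rabs r * Cmod c).
{ intros r; now rewrite Cmod_mult, Cmod_R. }
assert (HR : m / Cmod c * Cmod c = m) by (field; lra).
assert (Hp : 0 < m / Cmod c) by (apply Rdiv_lt_0_compat; lra).
set (u := (RtoC (m / Cmod c) * c)%C).
assert (Hu : Cmod u = m).
{ unfold u; rewrite HA, Rabs_pos_eq; lra. }
assert (Hu0 : u <> 0%C).
{ intros K; rewrite K, Cmod_0 in Hu; lra. }
assert (Hh : Cmod (d / u) <= 1).
{ rewrite Cmod_div, Hu by assumption.
  apply Rmult_le_reg_r with m; [lra|].
  replace (Cmod d / m * m) with (Cmod d) by (field; lra); lra. }
assert (Hpq := Rmax_Cmod (d / u)%C).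
exists u, (Re (d / u)), (Im (d / u)); repeat split; try lra.
- unfold u.
  replace (2 * c - RtoC (m / Cmod c) * c)%C
    with (RtoC (2 - m / Cmod c) * c)%C by (rewrite RtoC_minus; ring).
  rewrite HA.
  replace (Rabs (2 - m / Cmod c) * Cmod c) with (Rabs (2 * Cmod c - m)).
  2:{ replace (2 * Cmod c - m) with ((2 - m / Cmod c) * Cmod c) by lra.
      now rewrite Rabs_mult, (Rabs_pos_eq (Cmod c)). }
  assert (H : m = Cmod c \/ m = Cmod d) by (unfold m, Rmax; destruct Rle_dec; auto).
  apply Rabs_le; lra.
- eapply Rle_trans; [apply Rmax_l|]; eapply Rle_trans; [exact Hpq|lra].
- eapply Rle_trans; [apply Rmax_r|]; eapply Rle_trans; [exact Hpq|lra].
- replace (u * Re (d / u) + Ci * (u * Im (d / u)))%C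
    with (u * (Re (d / u) + Ci * Im (d / u)))%C by ring.
  replace (Re (d / u) + Ci * Im (d / u))%C with (d / u)%C.
  + now field.
  + apply injective_projections; simpl; ring.
Qed.

(** Holds because [(1 - t^2)^2 + t^2 <= 1] for [t] in the unit interval. *)
Lemma Cmod_rotate_le (u : C) (t p : R) : 0 <= t <= 1 -> Cmod u <= 1 ->
  Rabs p <= 1 ->
  Cmod (RtoC (1 - t ^ 2) * u + RtoC t * (Ci * (u * p)))%C <= 1.
Proof.
intros Ht Hu Hp.
replace (RtoC (1 - t ^ 2) * u + RtoC t * (Ci * (u * p)))%C
  with (((1 - t ^ 2)%R, (t * p)%R) * u)%C
  by (apply injective_projections; simpl; ring).
rewrite Cmod_mult.
assert (H : Cmod ((1 - t ^ 2)%R, (t * p)%R) <= 1).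
{ apply Cmod_le_sqr; [lra|simpl].
  assert (Hp2 : p * p <= 1) by (apply Rabs_le_between in Hp; nra).
  assert (0 <= t * t <= 1) by nra.
  assert (t * t * (p * p) <= t * t) by nra. nra. }
assert (H0 := Cmod_ge_0 u); assert (H1 := Cmod_ge_0 (1 - t ^ 2, t * p)); nra.
Qed.

(** * The sequence space *)

Lemma c0_dominated (s : nat -> C) (u v : c0) :
  (forall n, Cmod (s n) <= Cmod (u n) + Cmod (v n)) ->
  exists w : c0, forall n, w n = s n.
Proof.
intros H.
assert (Hs : filterlim s eventually (locally (RtoC 0))).
{ apply c0_cvg_Cmod; intros eps He.
  destruct (proj1 (c0_cvg_Cmod _) (c0_cvg u) (eps / 2)) as [N HN]; [lra|].
  destruct (proj1 (c0_cvg_Cmod _) (c0_cvg v) (eps / 2)) as [M HM]; [lra|].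
  exists (max N M); intros n Hn; specialize (H n).
  specialize (HN n ltac:(lia)); specialize (HM n ltac:(lia)); lra. }
now exists (C0 Hs).
Qed.

Lemma c0_norm_ge_0 (u : c0) : 0 <= c0_norm u.
Proof. eapply Rle_trans; [apply Cmod_ge_0|apply (c0_norm_ge u 0)]. Qed.

Lemma c0_coord_le (u : c0) (r : R) n : c0_norm u <= r -> Cmod (u n) <= r.
Proof. intros H; eapply Rle_trans; [apply c0_norm_ge|exact H]. Qed.

Lemma c0_norm_scal (k : C) (u : c0) :
  c0_norm (c0_scal k u) <= Cmod k * c0_norm u.
Proof.
apply c0_norm_le; intros n; simpl; rewrite Cmod_mult.
apply Rmult_le_compat_l; [apply Cmod_ge_0|apply c0_norm_ge].
Qed.

(** The coordinates of modulus at least [1/2] are finitely many, so one of them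
    realizes the supremum. *)
Lemma c0_norm_attained (u : c0) : c0_norm u = 1 -> exists k, Cmod (u k) = 1.
Proof.
intros H; apply NNPP; intros K.
assert (Hlt : forall n, Cmod (u n) < 1).
{ intros n; assert (Hn := c0_norm_ge u n).
  destruct (Req_dec (Cmod (u n)) 1) as [E|E]; [|lra].
  exfalso; apply K; now exists n. }
assert (Hfin : forall N, exists M, M < 1 /\
                forall n, (n < N)%nat -> Cmod (u n) <= M).
{ induction N as [|N (M & HM & IH)].
  - exists 0; split; [lra|lia].
  - exists (Rmax M (Cmod (u N))); split.
    + now apply Rmax_lub_lt.
    + intros n Hn; destruct (Nat.eq_dec n N) as [->|Hne]; [apply Rmax_r|].
      eapply Rle_trans; [apply IH; lia|apply Rmax_l]. }
destruct (proj1 (c0_cvg_Cmod _) (c0_cvg u) (1 / 2)) as [N HN]; [lra|].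
destruct (Hfin N) as (M & HM & HM').
assert (HB : c0_norm u <= Rmax M (1 / 2)).
{ apply c0_norm_le; intros n; destruct (Nat.lt_ge_cases n N) as [L|L].
  - eapply Rle_trans; [now apply HM'|apply Rmax_l].
  - eapply Rle_trans; [apply Rlt_le; now apply HN|apply Rmax_r]. }
assert (Rmax M (1 / 2) < 1) by (apply Rmax_lub_lt; lra); lra.
Qed.

Definition c0_linear (a : c0 -> C) : Prop :=
  (forall u v, a (c0_plus u v) = (a u + a v)%C) /\
  (forall k u, a (c0_scal k u) = (k * a u)%C).

Definition c0_sub (u v : c0) : c0 := c0_plus u (c0_opp v).

Lemma linear_sub (a : c0 -> C) u v :
  c0_linear a -> a (c0_sub u v) = (a u - a v)%C.
Proof.
intros [aD aZ]; unfold c0_sub; rewrite aD.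
replace (c0_opp v) with (c0_scal (- (1)) v)
  by (apply c0_ext; intros n; simpl; ring).
rewrite aZ; ring.
Qed.

(** * Complex uniform convexity of the dual *)

(** Since [a] and [b] are functionals on the sequence space, this says that
    their space is complex uniformly convex: a direction [b] along which every
    complex perturbation of [a] stays in the unit ball must be short when [a]
    is long. Write [y] as [u (p + i q)] where [u] dominates [y] and is still
    almost norming for [a], and test [a + l b] and [a - l b] on the two vectors
    [(1 - t^2) u + i t u p] and [(1 - t^2) u - i t u p] of the unit ball; in the
    sum only twice [(1 - t^2) a(u)] and [i l t b(u p)] survive, so
    [(1 - t^2) |a(u)| + t |b(u p)| <= 1] for a suitable [l]. *)
Lemma linear_complex_convexity (a b : c0 -> C) (y0 : c0) (t : R) :
  c0_linear a -> c0_linear b -> 0 < t <= 1 ->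
  (forall (l : C) y, Cmod l <= 1 -> c0_norm y <= 1 ->
     Cmod (a y + l * b y) <= 1) ->
  c0_norm y0 <= 1 -> 1 - t ^ 2 <= Cmod (a y0) ->
  forall y, c0_norm y <= 1 -> Cmod (b y) <= 6 * t.
Proof.
intros [aD aZ] [bD bZ] Ht H Hy0 Ha y Hy.
assert (Hpt : forall n, exists w : C * (R * R),
  Cmod (fst w) <= 1 /\ Cmod (fst w) <= Cmod (y0 n) + Cmod (y n) /\
  Cmod (2 * y0 n - fst w) <= 1 /\
  Rabs (fst (snd w)) <= 1 /\ Rabs (snd (snd w)) <= 1 /\
  y n = (fst w * fst (snd w) + Ci * (fst w * snd (snd w)))%C).
{ intros n.
  destruct (@Cmidpoint_dominating (y0 n) (y n)) as (u & p & q & Hw);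
    [now apply c0_coord_le..|].
  now exists (u, (p, q)). }
destruct (functional_choice Hpt) as [w Hw]; clear Hpt.
assert (Hdom : forall p : nat -> R, (forall n, Rabs (p n) <= 1) ->
  forall n, Cmod (fst (w n) * p n) <= Cmod (y0 n) + Cmod (y n)).
{ intros p Hp n; rewrite Cmod_mult, Cmod_R.
  destruct (Hw n) as (_ & K & _); specialize (Hp n).
  assert (K' := Cmod_ge_0 (fst (w n))); assert (K'' := Rabs_pos (p n)); nra. }
destruct (@c0_dominated (fun n => fst (w n)) y0 y) as [u Hu]; [apply Hw|].
destruct (@c0_dominated (fun n => fst (w n) * fst (snd (w n)))%C y0 y)
  as [v1 Hv1]; [apply Hdom; apply Hw|].
destruct (@c0_dominated (fun n => fst (w n) * snd (snd (w n)))%C y0 y)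
  as [v2 Hv2]; [apply Hdom; apply Hw|].
assert (Ha1 : forall x, c0_norm x <= 1 -> Cmod (a x) <= 1).
{ intros x Hx; replace (a x) with (a x + 0 * b x)%C by ring.
  apply H; [rewrite Cmod_0; lra|exact Hx]. }
assert (Hau : 1 - 2 * t ^ 2 <= Cmod (a u)).
{ set (u' := c0_plus (c0_scal 2 y0) (c0_scal (- (1)) u)).
  assert (Hu' : Cmod (a u') <= 1).
  { apply Ha1, c0_norm_le; intros n; simpl; rewrite Hu.
    replace (2 * y0 n + - (1) * fst (w n))%C with (2 * y0 n - fst (w n))%C
      by ring.
    apply Hw. }
  assert (E : (a u' + a u = 2 * a y0)%C) by (unfold u'; rewrite aD, !aZ; ring).
  assert (E' := Cmod_triangle (a u') (a u)).
  rewrite E, Cmod_mult, Cmod_R, Rabs_pos_eq in E' by lra; lra. }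
(* Real multipliers [p] keep [(1 - t^2) u + i t u p] and its counterpart with
   [- t] in the unit ball; a complex one would not. *)
assert (Hv : forall (v : c0) (p : nat -> R), (forall n, Rabs (p n) <= 1) ->
  (forall n, v n = fst (w n) * p n)%C -> Cmod (b v) <= 3 * t).
{ intros v p Hp Ev.
  pose (x := fun s : R => c0_plus (c0_scal (RtoC (1 - t ^ 2)) u)
                            (c0_scal (RtoC (s * t) * Ci) v)).
  assert (Hx : forall s, s = 1 \/ s = -1 -> c0_norm (x s) <= 1).
  { intros s Hs; apply c0_norm_le; intros n; simpl; rewrite Hu, Ev.
    replace (RtoC (s * t) * Ci * (fst (w n) * p n))%C
      with (RtoC t * (Ci * (fst (w n) * RtoC (s * p n))))%C
      by (rewrite !RtoC_mult; ring).
    apply Cmod_rotate_le; [lra|apply Hw|].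
    rewrite Rabs_mult; specialize (Hp n).
    destruct Hs as [-> | ->]; rewrite ?Rabs_R1, ?Rabs_m1; lra. }
  destruct (@Calign (RtoC (1 - t ^ 2) * a u) (Ci * RtoC t * b v))
    as (l & Hl & El).
  assert (H1 := H l (x 1) ltac:(lra) (Hx 1 ltac:(auto))).
  assert (H2 := H (- l)%C (x (-1)) ltac:(rewrite Cmod_opp; lra)
                  (Hx (-1) ltac:(auto))).
  assert (E : (a (x 1%R) + l * b (x 1%R) + (a (x (-1)%R) + - l * b (x (-1)%R)) =
          RtoC 2 * (RtoC (1 - t ^ 2) * a u + l * (Ci * RtoC t * b v)))%C).
  { unfold x; replace (-1 * t)%R with (- (1 * t))%R by ring.
    rewrite !aD, !bD, !aZ, !bZ, RtoC_opp, Rmult_1_l; ring. }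
  assert (T := Cmod_triangle (a (x 1) + l * b (x 1))
                 (a (x (-1)) + - l * b (x (-1)))).
  rewrite E, Cmod_mult, El, !Cmod_mult, !Cmod_R, Cmod_Ci in T.
  rewrite !Rabs_pos_eq in T by nra.
  assert (K := Cmod_ge_0 (b v)).
  assert (K1 : 0 <= t ^ 2 <= 1) by nra.
  assert (K2 : (1 - t ^ 2) * (1 - 2 * t ^ 2) <= (1 - t ^ 2) * Cmod (a u))
    by (apply Rmult_le_compat_l; lra).
  assert (K3 : t * Cmod (b v) <= t * (3 * t)) by nra.
  nra. }
replace y with (c0_plus v1 (c0_scal Ci v2)).
2:{ apply c0_ext; intros n; simpl; rewrite Hv1, Hv2; symmetry; apply Hw. }
rewrite bD, bZ.
eapply Rle_trans; [apply Cmod_triangle|]; rewrite Cmod_mult, Cmod_Ci.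
assert (K1 := Hv v1 _ (fun n => proj1 (proj2 (proj2 (proj2 (Hw n))))) Hv1).
assert (K2 := Hv v2 (fun n => snd (snd (w n))) ltac:(apply Hw) Hv2).
lra.
Qed.
(** * Maxima of Lipschitz functions *)

(** A form of compactness that passes directly to products and Lipschitz images,
    so that it reaches the finite-dimensional balls of the sequence space by
    induction on the dimension. *)
Definition attains_maxima (A : Type) (d : A -> A -> R) (K : A -> Prop) : Prop :=
  forall (f : A -> R) (L : R), 0 <= L ->
  (forall u v, f u - f v <= L * d u v) ->
  exists x, K x /\ forall w, K w -> f w <= f x.

(** The partial maximum [a |-> max_b f(a,b)] is again Lipschitz. *)
Lemma attains_maxima_pair (A T : Type) (dA : A -> A -> R) (dT : T -> T -> R)
  (KA : A -> Prop) (KT : T -> Prop) (f : A -> T -> R) (L : R) :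
  attains_maxima dA KA -> attains_maxima dT KT -> 0 <= L ->
  (forall a a' b, KT b -> f a b - f a' b <= L * dA a a') ->
  (forall a, exists L', 0 <= L' /\
     forall b b', f a b - f a b' <= L' * dT b b') ->
  exists a b, KA a /\ KT b /\
    forall a' b', KA a' -> KT b' -> f a' b' <= f a b.
Proof.
intros HA HT HL HfA HfT.
assert (Hb : forall a, exists b, KT b /\ forall b', KT b' -> f a b' <= f a b).
{ intros a; destruct (HfT a) as (L' & HL' & H); exact (HT _ _ HL' H). }
destruct (functional_choice Hb) as [g Hg].
destruct (HA (fun a => f a (g a)) L HL) as (a & Ka & Ha).
{ intros a a'; assert (H1 := HfA a a' (g a) (proj1 (Hg a))).
  assert (H2 := proj2 (Hg a') (g a) (proj1 (Hg a))); lra. }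
exists a, (g a); split; [exact Ka|split; [apply Hg|]].
intros a' b' Ka' Kb'; eapply Rle_trans; [now apply (proj2 (Hg a'))|now apply Ha].
Qed.

Lemma attains_maxima_interval :
  attains_maxima (fun s t => Rabs (s - t)) (fun s => -1 <= s <= 1).
Proof.
intros f L HL Hf.
destruct (@continuity_ab_maj f (-1) 1) as (x & Hx & Kx); [lra| |now exists x].
intros c _ e He; exists (e / (L + 1)); split.
{ apply Rdiv_lt_0_compat; lra. }
intros y [_ Hy]; revert Hy; simpl; unfold R_dist; intros Hy.
assert (H1 := Hf y c); assert (H2 := Hf c y).
rewrite (Rabs_minus_sym c y) in H2; assert (H0 := Rabs_pos (y - c)).
assert (H3 : Rabs (y - c) * (L + 1) < e).
{ apply Rmult_lt_reg_r with (/ (L + 1)); [apply Rinv_0_lt_compat; lra|].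
  rewrite Rmult_assoc, Rinv_r by lra; unfold Rdiv in Hy; lra. }
apply Rabs_lt_between; nra.
Qed.

Lemma Cmod_sub_sym (z w : C) : Cmod (z - w) = Cmod (w - z).
Proof. rewrite <- Cmod_opp; f_equal; ring. Qed.

Lemma Cmod_sub_le (z w : C) : Cmod z - Cmod w <= Cmod (z - w).
Proof.
assert (H := Cmod_triangle (z - w) w).
replace (z - w + w)%C with z in H by ring; lra.
Qed.

(** Presents the disc as a Lipschitz image of the square, hence of a product of
    intervals. *)
Definition disc_retraction (z : C) : C := (RtoC (/ Rmax 1 (Cmod z)) * z)%C.

Lemma disc_retraction_id z : Cmod z <= 1 -> disc_retraction z = z.
Proof.
intros H; unfold disc_retraction.
rewrite Rmax_left, Rinv_1 by exact H; ring.
Qed.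

Lemma disc_retraction_le z : Cmod (disc_retraction z) <= 1.
Proof.
unfold disc_retraction; set (m := Rmax 1 (Cmod z)).
assert (H1 : 1 <= m) by apply Rmax_l.
assert (H2 : Cmod z <= m) by apply Rmax_r.
assert (H3 : 0 < / m) by (apply Rinv_0_lt_compat; lra).
rewrite Cmod_mult, Cmod_R, Rabs_pos_eq by lra.
rewrite <- (Rinv_l m) by lra; apply Rmult_le_compat_l; lra.
Qed.

Lemma disc_retraction_lipschitz z w :
  Cmod (disc_retraction z - disc_retraction w) <= 2 * Cmod (z - w).
Proof.
assert (Hw := disc_retraction_le w).
assert (E : (disc_retraction z - disc_retraction w =
  RtoC (/ Rmax 1 (Cmod z)) *
    ((z - w) + RtoC (Rmax 1 (Cmod w) - Rmax 1 (Cmod z)) * disc_retraction w))%C).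
{ assert (Hz0 := Rmax_l 1 (Cmod z)); assert (Hw0 := Rmax_l 1 (Cmod w)).
  unfold disc_retraction; rewrite !RtoC_inv, RtoC_minus by lra.
  field; split; intros K; apply RtoC_inj in K; lra. }
rewrite E, Cmod_mult, Cmod_R.
assert (H1 : Rabs (/ Rmax 1 (Cmod z)) <= 1).
{ assert (H := Rmax_l 1 (Cmod z)).
  rewrite Rabs_pos_eq by (apply Rlt_le, Rinv_0_lt_compat; lra).
  apply Rle_trans with (/ 1); [|lra].
  apply Rinv_le_contravar; lra. }
assert (H2 : Rabs (Rmax 1 (Cmod w) - Rmax 1 (Cmod z)) <= Cmod (z - w)).
{ assert (K1 := Cmod_sub_le z w); assert (K2 := Cmod_sub_le w z).
  rewrite Cmod_sub_sym in K2; apply Rabs_le.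
  unfold Rmax; do 2 destruct Rle_dec; lra. }
assert (H3 := Cmod_triangle (z - w)
  (RtoC (Rmax 1 (Cmod w) - Rmax 1 (Cmod z)) * disc_retraction w)).
rewrite Cmod_mult, Cmod_R in H3.
assert (H4 := Rabs_pos (Rmax 1 (Cmod w) - Rmax 1 (Cmod z))).
assert (H5 := Cmod_ge_0 (disc_retraction w)).
assert (H6 := Rabs_pos (/ Rmax 1 (Cmod z))).
assert (H7 := Cmod_ge_0 (z - w)).
eapply Rle_trans with (1 * _); [apply Rmult_le_compat; auto using Cmod_ge_0|].
{ exact H3. }
nra.
Qed.

Lemma attains_maxima_disc :
  attains_maxima (fun z w => Cmod (z - w)) (fun z => Cmod z <= 1).
Proof.
intros f L HL Hf.
assert (Hg : forall z w, f (disc_retraction z) - f (disc_retraction w) <=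
               2 * L * Cmod (z - w)).
{ intros z w; eapply Rle_trans; [apply Hf|].
  assert (H := disc_retraction_lipschitz z w).
  rewrite (Rmult_comm 2 L), Rmult_assoc; now apply Rmult_le_compat_l. }
destruct (@attains_maxima_pair R R (fun s t => Rabs (s - t))
            (fun s t => Rabs (s - t)) (fun s => -1 <= s <= 1)
            (fun s => -1 <= s <= 1)
            (fun p q => f (disc_retraction (p, q))) (2 * L))
  as (p & q & _ & _ & H).
- exact attains_maxima_interval.
- exact attains_maxima_interval.
- lra.
- intros p p' q _; eapply Rle_trans; [apply Hg|].
  replace ((p, q) - (p', q))%C with (RtoC (p - p'))
    by (apply injective_projections; simpl; ring).
  rewrite Cmod_R; lra.
- intros p; exists (2 * L); split; [lra|].
  intros q q'; eapply Rle_trans; [apply Hg|].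
  replace ((p, q) - (p, q'))%C with (Ci * RtoC (q - q'))%C
    by (apply injective_projections; simpl; ring).
  rewrite Cmod_mult, Cmod_Ci, Cmod_R; lra.
- exists (disc_retraction (p, q)); split; [apply disc_retraction_le|].
  intros [s t] Hw; rewrite <- (disc_retraction_id Hw).
  assert (HR := Rmax_Cmod (s, t)); simpl in HR.
  assert (K1 := Rmax_l (Rabs s) (Rabs t)).
  assert (K2 := Rmax_r (Rabs s) (Rabs t)).
  apply H; apply Rabs_le_between; lra.
Qed.

Lemma eventually_zero_cvg (u : nat -> C) (N : nat) :
  (forall n, (N <= n)%nat -> u n = 0%C) ->
  filterlim u eventually (locally (RtoC 0)).
Proof.
intros H; apply c0_cvg_Cmod; intros eps He; exists N; intros n Hn.
now rewrite (H n Hn), Cmod_0.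
Qed.

Lemma delta_cvg (k : nat) :
  filterlim (fun n => if Nat.eqb n k then RtoC 1 else RtoC 0) eventually
    (locally (RtoC 0)).
Proof.
apply (@eventually_zero_cvg _ (S k)); intros n Hn.
destruct (Nat.eqb_spec n k); [lia|reflexivity].
Qed.

Definition c0_delta (k : nat) : c0 := C0 (delta_cvg k).

Definition finite_ball (N : nat) (u : c0) : Prop :=
  c0_norm u <= 1 /\ forall n, (N <= n)%nat -> u n = 0%C.

(** The ball of dimension [N + 1] is the image of the product of the ball of
    dimension [N] with a disc, under the Lipschitz map [(u, z) |-> u + z e_N]. *)
Lemma attains_maxima_finite_ball N :
  attains_maxima (fun u v => c0_norm (c0_sub u v)) (finite_ball N).
Proof.
induction N as [|N IH]; intros f L HL Hf.
{ exists c0_zero; split.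
  - split; [|reflexivity].
    apply c0_norm_le; intros n; simpl; rewrite Cmod_0; lra.
  - intros w [_ Hw]; replace w with c0_zero; [lra|].
    apply c0_ext; intros n; simpl; rewrite Hw; [reflexivity|lia]. }
destruct (@attains_maxima_pair c0 C (fun u v => c0_norm (c0_sub u v))
            (fun z w => Cmod (z - w)) (finite_ball N) (fun z => Cmod z <= 1)
            (fun u z => f (c0_plus u (c0_scal z (c0_delta N)))) L)
  as (u & z & [Hu Hu0] & Hz & H).
- exact IH.
- exact attains_maxima_disc.
- exact HL.
- intros u u' z _; eapply Rle_trans; [apply Hf|].
  apply Req_le; f_equal; f_equal; apply c0_ext; intros n; simpl; ring.
- intros u; exists L; split; [exact HL|].
  intros z z'; eapply Rle_trans; [apply Hf|].
  apply Rmult_le_compat_l; [exact HL|].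
  apply c0_norm_le; intros n; simpl.
  replace (u n + z * (if Nat.eqb n N then RtoC 1 else RtoC 0) +
           - (u n + z' * (if Nat.eqb n N then RtoC 1 else RtoC 0)))%C
    with ((z - z') * (if Nat.eqb n N then RtoC 1 else RtoC 0))%C by ring.
  rewrite Cmod_mult; assert (K := Cmod_ge_0 (z - z')).
  destruct (Nat.eqb n N); rewrite ?Cmod_1, ?Cmod_0; lra.
- exists (c0_plus u (c0_scal z (c0_delta N))); split; [split|].
  + apply c0_norm_le; intros n; simpl; destruct (Nat.eqb_spec n N) as [->|E].
    * rewrite Hu0, Cplus_0_l, Cmult_1_r by lia; exact Hz.
    * rewrite Cmult_0_r, Cplus_0_r; now apply c0_coord_le.
  + intros n Hn; simpl; rewrite Hu0 by lia.
    destruct (Nat.eqb_spec n N); [lia|ring].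
  + intros w [Hw Hw0].
    set (w' := c0_sub w (c0_scal (w N) (c0_delta N))).
    replace w with (c0_plus w' (c0_scal (w N) (c0_delta N)))
      by (apply c0_ext; intros n; simpl; ring).
    apply H; [split|now apply c0_coord_le].
    * apply c0_norm_le; intros n; simpl; destruct (Nat.eqb_spec n N) as [->|E].
      -- replace (w N + - (w N * 1))%C with (RtoC 0) by ring.
         rewrite Cmod_0; lra.
      -- replace (w n + - (w N * 0))%C with (w n) by ring.
         now apply c0_coord_le.
    * intros n Hn; simpl; destruct (Nat.eqb_spec n N) as [->|E]; [ring|].
      rewrite Hw0 by lia; ring.
Qed.

(** * Bilinear forms *)

(** [M] is any bound for the norm, so that perturbations and compositions of
    forms need no computation of a supremum. *)
Record c0_bilinear (B : c0 -> c0 -> C) (M : R) : Prop := {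
  linear_l : forall y, c0_linear (fun x => B x y);
  linear_r : forall x, c0_linear (B x);
  bound_ge_0 : 0 <= M;
  bilinear_le : forall x y, Cmod (B x y) <= M * c0_norm x * c0_norm y
}.

Lemma bilinear_flip B M : c0_bilinear B M -> c0_bilinear (fun x y => B y x) M.
Proof.
intros H; split; try apply H.
intros x y; eapply Rle_trans; [apply H|apply Req_le; ring].
Qed.

Lemma bilinear_le_ball B M x y : c0_bilinear B M ->
  c0_norm x <= 1 -> c0_norm y <= 1 -> Cmod (B x y) <= M.
Proof.
intros H Hx Hy; eapply Rle_trans; [apply (bilinear_le H)|].
assert (HM := bound_ge_0 H).
assert (K1 := c0_norm_ge_0 x); assert (K2 := c0_norm_ge_0 y).
assert (0 <= M * c0_norm x <= M) by nra; nra.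
Qed.

(** A bilinear form is Lipschitz in each variable, but not jointly on the whole
    product: hence two successive maximizations. *)
Lemma bilinear_max_finite_ball B M N : c0_bilinear B M ->
  exists x y, finite_ball N x /\ finite_ball N y /\
    forall x' y', finite_ball N x' -> finite_ball N y' ->
      Cmod (B x' y') <= Cmod (B x y).
Proof.
intros H; assert (HM := bound_ge_0 H).
apply (@attains_maxima_pair c0 c0 (fun u v => c0_norm (c0_sub u v))
         (fun u v => c0_norm (c0_sub u v)) (finite_ball N) (finite_ball N)
         (fun x y => Cmod (B x y)) M);
  auto using attains_maxima_finite_ball.
- intros x x' y [Hy _]; eapply Rle_trans; [apply Cmod_sub_le|].
  rewrite <- (@linear_sub (fun x => B x y) x x' (linear_l H y)).
  eapply Rle_trans; [apply (bilinear_le H)|].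
  assert (K1 := c0_norm_ge_0 (c0_sub x x')); assert (K2 := c0_norm_ge_0 y).
  assert (0 <= M * c0_norm (c0_sub x x')) by nra; nra.
- intros x; exists (M * c0_norm x); split.
  { apply Rmult_le_pos; auto using c0_norm_ge_0. }
  intros y y'; eapply Rle_trans; [apply Cmod_sub_le|].
  rewrite <- (linear_sub _ _ (linear_r H x)); apply (bilinear_le H).
Qed.

Lemma bilinear_add A B M M' : c0_bilinear A M -> c0_bilinear B M' ->
  c0_bilinear (fun x y => A x y + B x y)%C (M + M').
Proof.
intros HA HB; split.
- intros y; destruct (linear_l HA y) as [A1 A2], (linear_l HB y) as [B1 B2].
  split; intros; rewrite ?A1, ?A2, ?B1, ?B2; ring.
- intros x; destruct (linear_r HA x) as [A1 A2], (linear_r HB x) as [B1 B2].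
  split; intros; rewrite ?A1, ?A2, ?B1, ?B2; ring.
- apply Rplus_le_le_0_compat; [apply (bound_ge_0 HA)|apply (bound_ge_0 HB)].
- intros x y; eapply Rle_trans; [apply Cmod_triangle|].
  assert (K := bilinear_le HA x y); assert (K' := bilinear_le HB x y); lra.
Qed.

Lemma bilinear_opp B M : c0_bilinear B M -> c0_bilinear (fun x y => - B x y)%C M.
Proof.
intros HB; split.
- intros y; destruct (linear_l HB y) as [B1 B2].
  split; intros; rewrite ?B1, ?B2; ring.
- intros x; destruct (linear_r HB x) as [B1 B2].
  split; intros; rewrite ?B1, ?B2; ring.
- apply (bound_ge_0 HB).
- intros x y; rewrite Cmod_opp; apply (bilinear_le HB).
Qed.

Lemma bilinear_scal k B M : c0_bilinear B M ->
  c0_bilinear (fun x y => k * B x y)%C (Cmod k * M).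
Proof.
intros HB; split.
- intros y; destruct (linear_l HB y) as [B1 B2].
  split; intros; rewrite ?B1, ?B2; ring.
- intros x; destruct (linear_r HB x) as [B1 B2].
  split; intros; rewrite ?B1, ?B2; ring.
- apply Rmult_le_pos; [apply Cmod_ge_0|apply (bound_ge_0 HB)].
- intros x y; rewrite Cmod_mult, !Rmult_assoc, <- (Rmult_assoc M).
  apply Rmult_le_compat_l; [apply Cmod_ge_0|apply (bilinear_le HB)].
Qed.

Lemma bilinear_tensor (f g : c0 -> C) : c0_linear f -> c0_linear g ->
  (forall x, Cmod (f x) <= c0_norm x) -> (forall y, Cmod (g y) <= c0_norm y) ->
  c0_bilinear (fun x y => f x * g y)%C 1.
Proof.
intros [f1 f2] [g1 g2] Hf Hg; split; [| |lra|].
- intros y; split; intros; rewrite ?f1, ?f2; ring.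
- intros x; split; intros; rewrite ?g1, ?g2; ring.
- intros x y; rewrite Cmod_mult, Rmult_1_l.
  apply Rmult_le_compat; auto using Cmod_ge_0.
Qed.

Record c0_contraction (U : c0 -> c0) : Prop := {
  contraction_plus : forall u v, U (c0_plus u v) = c0_plus (U u) (U v);
  contraction_scal : forall k u, U (c0_scal k u) = c0_scal k (U u);
  contraction_le : forall u, c0_norm (U u) <= c0_norm u
}.

Lemma bilinear_comp B M U V : c0_bilinear B M ->
  c0_contraction U -> c0_contraction V ->
  c0_bilinear (fun x y => B (U x) (V y)) M.
Proof.
intros HB HU HV; assert (HM := bound_ge_0 HB); split; [| |exact HM|].
- intros y; destruct (linear_l HB (V y)) as [B1 B2]; split; intros.
  + now rewrite (contraction_plus HU), B1.
  + now rewrite (contraction_scal HU), B2.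
- intros x; destruct (linear_r HB (U x)) as [B1 B2]; split; intros.
  + now rewrite (contraction_plus HV), B1.
  + now rewrite (contraction_scal HV), B2.
- intros x y; eapply Rle_trans; [apply (bilinear_le HB)|].
  assert (K := c0_norm_ge_0 (U x)); assert (K' := c0_norm_ge_0 (V y)).
  assert (H1 := contraction_le HU x); assert (H2 := contraction_le HV y).
  apply Rmult_le_compat; [nra|lra| |lra]; nra.
Qed.

Lemma c0_bilinear_of_bounded (B : c0 -> c0 -> C) :
  @is_bounded_bilinear c0_CompleteNormedModule c0_CompleteNormedModule B ->
  c0_bilinear B
    (@bilinear_norm c0_CompleteNormedModule c0_CompleteNormedModule B).
Proof.
intros HB; destruct (bilinear_norm_lub HB) as [Hub _].
set (b := @bilinear_norm _ _ B) in *.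
assert (Hb : forall x y : c0, c0_norm x <= 1 -> c0_norm y <= 1 ->
               Cmod (B x y) <= b).
{ intros x y Hx Hy; apply (Hub (Cmod (B x y))); now exists x, y. }
destruct HB as [H1 H2 H3 H4 [M HM]].
assert (Hz : c0_norm c0_zero <= 1).
{ apply c0_norm_le; intros n; simpl; rewrite Cmod_0; lra. }
split.
- intros y; split; [intros u v; apply H1|intros k u; apply H2].
- intros x; split; [intros u v; apply H3|intros k u; apply H4].
- eapply Rle_trans; [apply Cmod_ge_0|apply (Hb c0_zero c0_zero Hz Hz)].
- intros x y.
  assert (HM' : Cmod (B x y) <= M * c0_norm x * c0_norm y) by apply HM.
  destruct (Req_dec (c0_norm x) 0) as [Ex|Ex]; [rewrite Ex in *; lra|].
  destruct (Req_dec (c0_norm y) 0) as [Ey|Ey]; [rewrite Ey in *; lra|].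
  assert (Nx := c0_norm_ge_0 x); assert (Ny := c0_norm_ge_0 y).
  assert (Hn : forall u, 0 < c0_norm u ->
            c0_norm (c0_scal (RtoC (/ c0_norm u)) u) <= 1).
  { intros u Hu; eapply Rle_trans; [apply c0_norm_scal|].
    rewrite Cmod_R, Rabs_pos_eq by (apply Rlt_le, Rinv_0_lt_compat; lra).
    rewrite Rinv_l; lra. }
  assert (K := Hb _ _ (Hn x ltac:(lra)) (Hn y ltac:(lra))).
  assert (E : B (c0_scal (RtoC (/ c0_norm x)) x) (c0_scal (RtoC (/ c0_norm y)) y)
            = (RtoC (/ c0_norm x) * (RtoC (/ c0_norm y) * B x y))%C).
  { etransitivity; [apply H2|]; f_equal; apply H4. }
  rewrite E, !Cmod_mult, !Cmod_R, !Rabs_pos_eq in K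
    by (apply Rlt_le, Rinv_0_lt_compat; lra).
  apply (Rmult_le_compat_l (c0_norm x * c0_norm y)) in K; [|nra].
  replace (c0_norm x * c0_norm y * (/ c0_norm x * (/ c0_norm y * Cmod (B x y))))
    with (Cmod (B x y)) in K by (field; lra).
  lra.
Qed.

Lemma bounded_of_c0_bilinear (B : c0 -> c0 -> C) M : c0_bilinear B M ->
  @is_bounded_bilinear c0_CompleteNormedModule c0_CompleteNormedModule B.
Proof.
intros HB; split.
- intros x1 x2 y; apply (linear_l HB y).
- intros k x y; apply (linear_l HB y).
- intros x y1 y2; apply (linear_r HB x).
- intros k x y; apply (linear_r HB x).
- exists M; intros x y; apply (bilinear_le HB).
Qed.

Lemma bilinear_norm_le (B : c0 -> c0 -> C) M r : c0_bilinear B M ->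
  (forall x y, c0_norm x <= 1 -> c0_norm y <= 1 -> Cmod (B x y) <= r) ->
  @bilinear_norm c0_CompleteNormedModule c0_CompleteNormedModule B <= r.
Proof.
intros HB Hr.
destruct (bilinear_norm_lub (bounded_of_c0_bilinear HB)) as [_ Hlub].
apply (Hlub (Finite r)); intros s (x & y & Hx & Hy & ->); now apply Hr.
Qed.

(** * Transport of a norming vector *)

Lemma c0_truncation (u : c0) (d : R) : 0 < d -> exists N0, forall N, (N0 <= N)%nat ->
  exists u' : c0, c0_norm u' <= c0_norm u /\ (forall n, (N <= n)%nat -> u' n = 0%C) /\
    c0_norm (c0_sub u u') <= d.
Proof.
intros Hd; destruct (proj1 (c0_cvg_Cmod _) (c0_cvg u) d Hd) as [N0 HN0].
exists N0; intros N HN.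
destruct (@c0_dominated (fun n => if Nat.ltb n N then u n else 0%C) u c0_zero)
  as [u' Hu'].
{ intros n; simpl; rewrite Cmod_0; destruct (Nat.ltb n N); rewrite ?Cmod_0;
    assert (K := Cmod_ge_0 (u n)); lra. }
exists u'; split; [|split].
- apply c0_norm_le; intros n; rewrite Hu'; destruct (Nat.ltb n N).
  + apply c0_norm_ge.
  + rewrite Cmod_0; apply c0_norm_ge_0.
- intros n Hn; rewrite Hu'; destruct (Nat.ltb_spec n N); [lia|reflexivity].
- apply c0_norm_le; intros n; simpl; rewrite Hu'.
  destruct (Nat.ltb_spec n N) as [K|K].
  + replace (u n + - u n)%C with (RtoC 0) by ring; rewrite Cmod_0; lra.
  + replace (u n + - 0)%C with (u n) by ring.
    apply Rlt_le, HN0; lia.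
Qed.

Lemma Cmod_sqr_add_sub (z w : C) :
  Cmod (z + w) ^ 2 + Cmod (w - z) ^ 2 = 2 * Cmod z ^ 2 + 2 * Cmod w ^ 2.
Proof. rewrite !Cmod2_alt; destruct z, w; simpl; ring. Qed.

Lemma Cmod_midpoint_le (z w : C) (e : R) : Cmod z <= 1 -> Cmod w <= 1 ->
  0 <= e <= 1 -> e <= Cmod (w - z) -> Cmod (RtoC (1 / 2) * (z + w)) <= 1 - e ^ 2 / 8.
Proof.
intros Hz Hw He H; rewrite Cmod_mult, Cmod_R, Rabs_pos_eq by lra.
assert (E := Cmod_sqr_add_sub z w).
assert (Kz := Cmod_ge_0 z); assert (Kw := Cmod_ge_0 w).
assert (K := Cmod_ge_0 (z + w)).
assert (H1 : Cmod z ^ 2 <= 1) by nra; assert (H2 : Cmod w ^ 2 <= 1) by nra.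
assert (H3 : e ^ 2 <= Cmod (w - z) ^ 2) by nra.
assert (H4 : 0 <= e ^ 2 <= 1) by nra.
nra.
Qed.

(** The vector [x] norms a perturbation of [B] but can be far from [x0]; here it
    is exchanged for a unit vector [x1] near [x0], by means of a contraction [U]
    that sends [x1] to [x] and that [B] barely distinguishes from the identity.

    The coordinates where [x] and [x0] differ by at least [e], or where [x]
    vanishes because they are beyond [N], are called bad. There [x0] and [x]
    average to modulus at most [1 - e^2/8], so the midpoint can be perturbed by
    any [(e^2/8) l z] with [z] in the unit ball and supported on bad coordinates;
    as it still nearly norms [B(., y0)], complex convexity bounds [B(z, .)].

    Let [x1] be [x0] on the bad coordinates and [x] on the good ones. On the good
    coordinates [U] is the identity; on the bad ones it returns the multiple of
    [x] by [conj(x0_k) w_k], where [|x0_k| = 1], because this functional of [w]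
    has norm [1] and equals [1] at [x1]. The coordinate [k] itself, if good, is
    treated like a bad one: this makes [x1_k = x0_k], so that [x1] has norm [1],
    and costs only [|x_k - x0_k| < e]. *)
Lemma vector_transport (B : c0 -> c0 -> C) (x0 y0 x : c0) (N : nat) (t e : R) :
  c0_bilinear B 1 -> 0 < t <= 1 -> 0 < e < 1 ->
  c0_norm x0 = 1 -> c0_norm y0 <= 1 -> finite_ball N x ->
  2 * (1 - t ^ 2) <= Cmod (B x0 y0 + B x y0) ->
  exists (x1 : c0) (U : c0 -> c0),
    c0_norm x1 = 1 /\ c0_norm (c0_sub x0 x1) <= e /\
    c0_contraction U /\ U x1 = x /\
    (forall w, c0_norm w <= 1 -> finite_ball N (U w)) /\
    (forall w v, c0_norm w <= 1 -> c0_norm v <= 1 ->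
       Cmod (B (c0_sub (U w) w) v) <= 96 * t / e ^ 2 + e).
Proof.
intros HB Ht He Hx0 Hy0 [Hx HxN] H0.
destruct (c0_norm_attained Hx0) as [k Hk].
pose (bad := fun n => if le_lt_dec N n then true else
                if Rle_dec e (Cmod (x n - x0 n)) then true else false).
assert (Hgood : forall n, bad n = false -> (n < N)%nat /\ Cmod (x n - x0 n) < e).
{ intros n; unfold bad; destruct le_lt_dec; [discriminate|].
  destruct Rle_dec; [discriminate|]; intros _; split; [assumption|lra]. }
pose (c := e ^ 2 / 8).
assert (Hc : 0 < c <= 1 / 8) by (unfold c; nra).
assert (Hbad : forall n, bad n = true ->
          Cmod (RtoC (1 / 2) * (x0 n + x n)) <= 1 - c).
{ intros n; assert (K0 := @c0_coord_le x0 1 n ltac:(lra)).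
  unfold bad; destruct le_lt_dec as [L|L].
  - intros _; rewrite HxN, Cplus_0_r, Cmod_mult, Cmod_R, Rabs_pos_eq by (lia || lra).
    lra.
  - destruct Rle_dec as [L'|L']; [|discriminate]; intros _.
    apply Cmod_midpoint_le; try lra; now apply c0_coord_le. }
assert (Hsmall : forall z, c0_norm z <= 1 -> (forall n, bad n = false -> z n = 0%C) ->
          forall v, c0_norm v <= 1 -> Cmod (B z v) <= 48 * t / e ^ 2).
{ intros z Hz Hz0 v Hv.
  set (mid := c0_scal (RtoC (1 / 2)) (c0_plus x0 x)).
  destruct (linear_r HB z) as [zD zZ].
  assert (K : Cmod (RtoC c * B z v) <= 6 * t).
  { apply (@linear_complex_convexity (B mid) (fun v => RtoC c * B z v)%C y0 t);
      auto.
    - apply (linear_r HB).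
    - split; intros; rewrite ?zD, ?zZ; ring.
    - intros l y Hl Hy.
      set (p := c0_plus mid (c0_scal (l * RtoC c) z)).
      replace (B mid y + l * (RtoC c * B z y))%C with (B p y).
      + apply (bilinear_le_ball HB); [|exact Hy].
        apply c0_norm_le; intros n; simpl.
        eapply Rle_trans; [apply Cmod_triangle|].
        destruct (bad n) eqn:En.
        * assert (K1 := Hbad n En); assert (K2 := c0_coord_le n Hz).
          rewrite !(Cmod_mult _ (z n)), (Cmod_mult l), (Cmod_R c).
          rewrite (Rabs_pos_eq c) by lra.
          assert (K3 := Cmod_ge_0 (z n)); assert (K4 := Cmod_ge_0 l).
          assert (0 <= Cmod l * c <= c) by nra; nra.
        * rewrite (Hz0 n En), Cmult_0_r, Cmod_0, Rplus_0_r.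
          rewrite Cmod_mult, Cmod_R, Rabs_pos_eq by lra.
          assert (K1 := Cmod_triangle (x0 n) (x n)).
          assert (K2 := @c0_coord_le x0 1 n ltac:(lra)).
          assert (K3 := c0_coord_le n Hx); lra.
      + unfold p; destruct (linear_l HB y) as [pD pZ].
        rewrite pD, pZ; ring.
    - unfold mid; destruct (linear_l HB y0) as [pD pZ].
      rewrite pZ, pD, Cmod_mult, Cmod_R, Rabs_pos_eq by lra; lra. }
  rewrite Cmod_mult, Cmod_R, Rabs_pos_eq in K by lra.
  apply Rmult_le_reg_l with c; [lra|].
  replace (c * (48 * t / e ^ 2)) with (6 * t) by (unfold c; field; lra).
  exact K. }
(* the coordinates on which [U] is the identity *)
pose (keep := fun n => andb (negb (bad n)) (negb (Nat.eqb n k))).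
destruct (@c0_dominated (fun n => if keep n then x n else x0 n) x x0) as [x1 Hx1].
{ intros n; assert (K1 := Cmod_ge_0 (x n)); assert (K2 := Cmod_ge_0 (x0 n)).
  destruct (keep n); lra. }
assert (HU : forall w : c0, exists u : c0, forall n,
          u n = if keep n then w n else (Cconj (x0 k) * w k * x n)%C).
{ intros w.
  apply (@c0_dominated _ w (c0_scal (Cconj (x0 k) * w k) x)); intros n; simpl.
  assert (K1 := Cmod_ge_0 (w n)).
  assert (K2 := Cmod_ge_0 (Cconj (x0 k) * w k * x n)).
  destruct (keep n); lra. }
destruct (functional_choice HU) as [U HUn]; clear HU.
assert (Hkeep : keep k = false).
{ unfold keep; rewrite Nat.eqb_refl; now destruct (bad k). }
assert (Hphi : forall (w : c0) n, Cmod (Cconj (x0 k) * w k * x n) <= c0_norm w).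
{ intros w n; rewrite !Cmod_mult, Cmod_conj, Hk, Rmult_1_l.
  assert (K1 := c0_norm_ge w k); assert (K2 := Cmod_ge_0 (w k)).
  assert (K3 := c0_coord_le n Hx); assert (K4 := Cmod_ge_0 (x n)); nra. }
assert (Hconj : (Cconj (x0 k) * x0 k = 1)%C).
{ rewrite Cmult_comm, <- Cmod2_conj, Hk; apply f_equal; ring. }
assert (HUle : forall w, c0_norm (U w) <= c0_norm w).
{ intros w; apply c0_norm_le; intros n; rewrite HUn.
  destruct (keep n); [apply c0_norm_ge|apply Hphi]. }
exists x1, U; split; [|split; [|split; [|split; [|split]]]].
- apply Rle_antisym.
  + apply c0_norm_le; intros n; rewrite Hx1.
    destruct (keep n); apply c0_coord_le; lra.
  + rewrite <- Hk; replace (x0 k) with (x1 k) by now rewrite Hx1, Hkeep.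
    apply c0_norm_ge.
- apply c0_norm_le; intros n; simpl; rewrite Hx1.
  destruct (keep n) eqn:En.
  + apply andb_prop in En; destruct En as [En _]; apply Bool.negb_true_iff in En.
    change (Cmod (x0 n - x n) <= e); rewrite Cmod_sub_sym.
    apply Rlt_le, Hgood, En.
  + replace (x0 n + - x0 n)%C with (RtoC 0) by ring; rewrite Cmod_0; lra.
- split; [| |exact HUle].
  + intros u v; apply c0_ext; intros n; simpl; rewrite !HUn; simpl.
    destruct (keep n); ring.
  + intros l u; apply c0_ext; intros n; simpl; rewrite !HUn; simpl.
    destruct (keep n); ring.
- apply c0_ext; intros n; rewrite HUn, !Hx1, Hkeep, Hconj.
  destruct (keep n); ring.
- intros w Hw; split; [eapply Rle_trans; [apply HUle|exact Hw]|].
  intros n Hn; rewrite HUn, (HxN n Hn); destruct (keep n) eqn:En; [|ring].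
  apply andb_prop in En; destruct En as [En _]; apply Bool.negb_true_iff in En.
  apply Hgood in En; lia.
- intros w v Hw Hv.
  (* [r] is the sum of [2 z], supported on bad coordinates, and of [s], which
     lives on the coordinate [k] only *)
  set (r := c0_sub (U w) w).
  assert (Hr : c0_norm r <= 2).
  { apply c0_norm_le; intros n; simpl.
    eapply Rle_trans; [apply Cmod_triangle|]; rewrite Cmod_opp.
    assert (K1 := HUle w); assert (K2 := c0_norm_ge (U w) n).
    assert (K3 := c0_norm_ge w n); lra. }
  destruct (@c0_dominated (fun n => if bad n then (RtoC (1 / 2) * r n)%C else 0%C)
              r c0_zero) as [z Hz].
  { intros n; change (c0_zero n) with (RtoC 0); rewrite Cmod_0.
    assert (K := Cmod_ge_0 (r n)).
    destruct (bad n);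
      [rewrite Cmod_mult, Cmod_R, Rabs_pos_eq by lra|rewrite Cmod_0]; lra. }
  set (s := c0_sub r (c0_scal 2 z)).
  assert (Hz1 : c0_norm z <= 1).
  { apply c0_norm_le; intros n; rewrite Hz; destruct (bad n).
    - assert (K := c0_coord_le n Hr).
      rewrite Cmod_mult, Cmod_R, Rabs_pos_eq; lra.
    - rewrite Cmod_0; lra. }
  assert (Hs : c0_norm s <= e).
  { apply c0_norm_le; intros n.
    change (s n) with (r n + - (2 * z n))%C; rewrite Hz.
    destruct (bad n) eqn:En.
    - replace (r n + - (2 * (RtoC (1 / 2) * r n)))%C
        with (RtoC (1 - 2 * (1 / 2)) * r n)%C
        by (rewrite RtoC_minus, RtoC_mult; ring).
      rewrite Cmod_mult, Cmod_R; replace (1 - 2 * (1 / 2)) with 0 by lra.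
      rewrite Rabs_R0; lra.
    - replace (r n + - (2 * 0))%C with (r n) by ring; unfold r; simpl.
      rewrite HUn; unfold keep; rewrite En; simpl.
      destruct (Nat.eqb_spec n k) as [->|Hnk]; simpl.
      + replace (Cconj (x0 k) * w k * x k + - w k)%C
          with (Cconj (x0 k) * w k * (x k - x0 k))%C.
        2:{ transitivity (Cconj (x0 k) * w k * x k
                          - (Cconj (x0 k) * x0 k) * w k)%C; [ring|].
            rewrite Hconj; ring. }
        rewrite !Cmod_mult, Cmod_conj, Hk, Rmult_1_l.
        assert (K1 := c0_coord_le k Hw); assert (K2 := Cmod_ge_0 (w k)).
        assert (K3 := proj2 (Hgood k En)); assert (K4 := Cmod_ge_0 (x k - x0 k)).
        nra.
      + replace (w n + - w n)%C with (RtoC 0) by ring; rewrite Cmod_0; lra. }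
  replace r with (c0_plus (c0_scal 2 z) s)
    by (apply c0_ext; intros n; simpl; ring).
  destruct (linear_l HB v) as [vD vZ]; rewrite vD, vZ.
  eapply Rle_trans; [apply Cmod_triangle|].
  rewrite Cmod_mult, Cmod_R, Rabs_pos_eq by lra.
  assert (K1 := Hsmall z Hz1 ltac:(intros n En; now rewrite Hz, En) v Hv).
  assert (K2 := bilinear_le HB s v).
  assert (K3 := c0_norm_ge_0 s); assert (K4 := c0_norm_ge_0 v).
  replace (96 * t / e ^ 2) with (2 * (48 * t / e ^ 2)) by (field; lra).
  nra.
Qed.

Theorem corollary3 : BPBp_bilinear c0_CompleteNormedModule c0_CompleteNormedModule.
Proof.
intros eps Heps.
(* [t] makes the convexity error [96 t / e^2] equal to [e]; the six errors of
   size [e] in the distance from [B] then add up to less than [eps] *)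
pose (e := eps / 8); pose (t := e ^ 3 / 96).
assert (He : 0 < e < 1 / 8) by (unfold e; lra).
assert (Ht : 0 < t <= 1).
{ assert (0 < e ^ 3 <= 1) by (split; [apply pow_lt; lra|]; simpl; nra).
  unfold t; lra. }
assert (Hte : 96 * t / e ^ 2 = e) by (unfold t; field; lra).
assert (Ht2 : 0 < t ^ 2 <= 1) by nra.
(* chosen so that [(1 - eta) (1 + e (1 - eta)) >= 1 + e (1 - t^2)] *)
pose (eta := e * t ^ 2 / 2).
assert (Heta : 0 < eta <= t ^ 2) by (unfold eta; nra).
exists eta; split; [lra|].
intros B HB HB1 x0 y0 Hx0 Hy0 Hlt.
change (c0_norm x0 = 1) in Hx0; change (c0_norm y0 = 1) in Hy0.
apply c0_bilinear_of_bounded in HB; rewrite HB1 in HB; clear HB1.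
set (beta := Cmod (B x0 y0)) in Hlt.
destruct (Cphase (B x0 y0)) as (kap & Hkap & Ekap).
pose (S := fun x y => (B x y + RtoC e * kap * (B x y0 * B x0 y))%C).
assert (Hle1 : forall x y, c0_norm x <= 1 -> c0_norm y <= 1 -> Cmod (B x y) <= 1)
  by (intros x y; apply (bilinear_le_ball HB)).
assert (HS : c0_bilinear S (1 + e)).
{ replace (1 + e) with (1 + Cmod (RtoC e * kap) * 1).
  2:{ rewrite Cmod_mult, Cmod_R, Hkap, Rabs_pos_eq; lra. }
  apply bilinear_add; [exact HB|]; apply bilinear_scal, bilinear_tensor.
  - apply (linear_l HB).
  - apply (linear_r HB).
  - intros x; assert (K := bilinear_le HB x y0); rewrite Hy0 in K; lra.
  - intros y; assert (K := bilinear_le HB x0 y); rewrite Hx0 in K; lra. }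
assert (HSB : forall x y, Cmod (S x y - B x y) <= e * (Cmod (B x y0) * Cmod (B x0 y))).
{ intros x y; unfold S.
  replace (B x y + RtoC e * kap * (B x y0 * B x0 y) - B x y)%C
    with (RtoC e * kap * (B x y0 * B x0 y))%C by ring.
  rewrite !Cmod_mult, Cmod_R, Hkap, Rabs_pos_eq; lra. }
assert (HS0 : 1 + e * (1 - t ^ 2) < Cmod (S x0 y0)).
{ replace (S x0 y0) with (RtoC (1 + e * beta) * B x0 y0)%C.
  2:{ unfold S; transitivity (B x0 y0 + RtoC e * (kap * B x0 y0) * B x0 y0)%C;
        [|ring].
      rewrite Ekap, RtoC_plus, RtoC_mult; fold beta; ring. }
  rewrite Cmod_mult, Cmod_R; fold beta.
  rewrite Rabs_pos_eq by nra.
  assert (K1 : 2 * eta = e * t ^ 2) by (unfold eta; lra).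
  assert (K2 : 0 < 1 - eta) by nra.
  assert (K3 : 0 < (beta - (1 - eta)) * (1 + e * (beta + (1 - eta))))
    by (apply Rmult_lt_0_compat; nra).
  assert (K4 : 0 <= e * eta <= eta / 8) by nra.
  assert (K5 : 0 <= e * eta * eta) by nra.
  nra. }
assert (HN : exists N xN yN, finite_ball N xN /\ finite_ball N yN /\
               1 + e * (1 - t ^ 2) <= Cmod (S xN yN)).
{ set (d := (Cmod (S x0 y0) - (1 + e * (1 - t ^ 2))) / 4).
  assert (Hd : 0 < d) by (unfold d; lra).
  destruct (c0_truncation x0 Hd) as [N1 HN1], (c0_truncation y0 Hd) as [N2 HN2].
  destruct (HN1 (max N1 N2) ltac:(lia)) as (xN & Hx & Hx' & Hxd).
  destruct (HN2 (max N1 N2) ltac:(lia)) as (yN & Hy & Hy' & Hyd).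
  rewrite Hx0 in Hx; rewrite Hy0 in Hy.
  exists (max N1 N2), xN, yN; split; [now split|split; [now split|]].
  assert (K1 : Cmod (S (c0_sub x0 xN) y0) <= 2 * d).
  { eapply Rle_trans; [apply (bilinear_le HS)|]; rewrite Hy0.
    assert (K := c0_norm_ge_0 (c0_sub x0 xN)); nra. }
  assert (K2 : Cmod (S xN (c0_sub y0 yN)) <= 2 * d).
  { eapply Rle_trans; [apply (bilinear_le HS)|].
    assert (K := c0_norm_ge_0 (c0_sub y0 yN)); assert (K' := c0_norm_ge_0 xN).
    assert (0 <= (1 + e) * c0_norm xN <= 2) by nra; nra. }
  rewrite (@linear_sub (fun x => S x y0) x0 xN (linear_l HS y0)) in K1.
  rewrite (@linear_sub (S xN) y0 yN (linear_r HS xN)) in K2.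
  assert (K3 := Cmod_sub_le (S x0 y0) (S xN y0)).
  assert (K4 := Cmod_sub_le (S xN y0) (S xN yN)).
  unfold d in *; lra. }
destruct HN as (N & xN & yN & HxN & HyN & HSN).
destruct (bilinear_max_finite_ball N HS) as (x' & y' & Hx' & Hy' & Hmax).
set (m := Cmod (S x' y')) in *.
assert (Hm : 1 + e * (1 - t ^ 2) <= m).
{ eapply Rle_trans; [exact HSN|now apply Hmax]. }
assert (Hm2 : m <= 1 + e) by (apply (bilinear_le_ball HS); [apply Hx'|apply Hy']).
(* from [m <= 1 + e |B(x', y0)| |B(x0, y')|] *)
assert (Hfg : 1 - t ^ 2 <= Cmod (B x' y0) /\ 1 - t ^ 2 <= Cmod (B x0 y')).
{ assert (K1 := HSB x' y'); assert (K2 := Cmod_sub_le (S x' y') (B x' y')).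
  fold m in K2; destruct Hx' as [Hx' _], Hy' as [Hy' _].
  assert (K3 := Hle1 x' y' Hx' Hy').
  assert (K4 := Hle1 x' y0 Hx' ltac:(lra)).
  assert (K5 := Hle1 x0 y' ltac:(lra) Hy').
  assert (K6 := Cmod_ge_0 (B x' y0)); assert (K7 := Cmod_ge_0 (B x0 y')).
  assert (K8 : 1 - t ^ 2 <= Cmod (B x' y0) * Cmod (B x0 y')).
  { apply Rmult_le_reg_l with e; lra. }
  split; nra. }
destruct (@Calign (B x0 y0) (B x' y0)) as (l & Hl & El).
destruct (@Calign (B x0 y0) (B x0 y')) as (mu & Hmu & Emu).
fold beta in El, Emu.
assert (Hrot : forall k u, Cmod k = 1 -> finite_ball N u -> finite_ball N (c0_scal k u)).
{ intros k u Hk [Hu HuN]; split.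
  - eapply Rle_trans; [apply c0_norm_scal|]; rewrite Hk; lra.
  - intros n Hn; simpl; rewrite HuN by exact Hn; ring. }
assert (HSmax : Cmod (S (c0_scal l x') (c0_scal mu y')) = m).
{ destruct (linear_l HS (c0_scal mu y')) as [_ K]; rewrite K.
  destruct (linear_r HS x') as [_ K']; rewrite K'.
  rewrite !Cmod_mult, Hl, Hmu; fold m; ring. }
destruct (@vector_transport B x0 y0 (c0_scal l x') N t e)
  as (x1 & U & Hx1 & Hd1 & HU & EU & HUN & HUB); auto; try lra.
{ destruct (linear_l HB y0) as [_ K]; rewrite K; lra. }
destruct (@vector_transport (fun y x => B x y) y0 x0 (c0_scal mu y') N t e)
  as (y1 & V & Hy1 & Hd2 & HV & EV & HVN & HVB); auto; try lra.
{ now apply bilinear_flip. }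
{ destruct (linear_r HB x0) as [_ K]; rewrite K; lra. }
rewrite Hte in HUB, HVB.
assert (Hm1 : 1 <= m) by nra.
pose (T := fun w v => (RtoC (/ m) * S (U w) (V v))%C).
assert (HT : c0_bilinear T (Cmod (RtoC (/ m)) * (1 + e))).
{ apply bilinear_scal; now apply bilinear_comp. }
assert (HSm : forall w v, c0_norm w <= 1 -> c0_norm v <= 1 -> Cmod (S (U w) (V v)) <= m).
{ intros w v Hw Hv; apply Hmax; auto. }
assert (Hinv : 0 < / m) by (apply Rinv_0_lt_compat; lra).
assert (Hinvm : / m * m = 1) by (field; lra).
assert (HT1 : forall w v, c0_norm w <= 1 -> c0_norm v <= 1 -> Cmod (T w v) <= 1).
{ intros w v Hw Hv; unfold T; rewrite Cmod_mult, Cmod_R, Rabs_pos_eq by lra.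
  rewrite <- Hinvm; apply Rmult_le_compat_l; [lra|auto]. }
assert (HTx : Cmod (T x1 y1) = 1).
{ unfold T; rewrite EU, EV, Cmod_mult, HSmax, Cmod_R, Rabs_pos_eq; lra. }
exists x1, y1, T.
split; [exact Hx1|]; split; [exact Hy1|].
split; [exact (bounded_of_c0_bilinear HT)|].
split; [|split; [exact HTx|split; [|split]]].
- apply Rle_antisym; [now apply (bilinear_norm_le HT)|].
  rewrite <- HTx; apply (bilinear_norm_lub (bounded_of_c0_bilinear HT)).
  exists x1, y1; repeat split; apply Req_le; assumption.
- apply Rle_lt_trans with e; [exact Hd1|unfold e; lra].
- apply Rle_lt_trans with e; [exact Hd2|unfold e; lra].
- apply Rle_lt_trans with (6 * e); [|unfold e; lra].
  apply (bilinear_norm_le (bilinear_add HT (bilinear_opp HB))).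
  intros w v Hw Hv.
  assert (HVv : c0_norm (V v) <= 1) by (apply HVN; exact Hv).
  assert (HUw : c0_norm (U w) <= 1) by (apply HUN; exact Hw).
  replace (T w v + - B w v)%C with
    (RtoC (/ m - 1) * S (U w) (V v) +
     (S (U w) (V v) - B (U w) (V v)) +
     B (c0_sub (U w) w) (V v) + B w (c0_sub (V v) v))%C.
  2:{ rewrite (@linear_sub (fun x => B x (V v)) (U w) w (linear_l HB (V v))).
      rewrite (@linear_sub (B w) (V v) v (linear_r HB w)).
      unfold T; rewrite RtoC_minus; ring. }
  assert (K1 : Cmod (RtoC (/ m - 1) * S (U w) (V v)) <= e).
  { assert (/ m <= 1) by nra.
    rewrite Cmod_mult, Cmod_R, Rabs_left1 by lra.
    apply Rle_trans with (- (/ m - 1) * m); [|lra].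
    apply Rmult_le_compat_l; [lra|auto]. }
  assert (K2 : Cmod (S (U w) (V v) - B (U w) (V v)) <= e).
  { eapply Rle_trans; [apply HSB|].
    assert (J1 := Hle1 (U w) y0 HUw ltac:(lra)).
    assert (J2 := Hle1 x0 (V v) ltac:(lra) HVv).
    assert (J3 := Cmod_ge_0 (B (U w) y0)); assert (J4 := Cmod_ge_0 (B x0 (V v))).
    assert (Cmod (B (U w) y0) * Cmod (B x0 (V v)) <= 1) by nra; nra. }
  assert (K3 := HUB w (V v) Hw HVv); assert (K4 := HVB v w Hv Hw).
  cbv beta in K4.
  eapply Rle_trans; [apply Cmod_triangle|].
  assert (K5 := Cmod_triangle
    (RtoC (/ m - 1) * S (U w) (V v) + (S (U w) (V v) - B (U w) (V v)))
    (B (c0_sub (U w) w) (V v))).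
  assert (K6 := Cmod_triangle (RtoC (/ m - 1) * S (U w) (V v))
                  (S (U w) (V v) - B (U w) (V v))).
  lra.
Qed.
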